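(* Let $\alpha\in\mathbb{Q}$ with $\alpha\ge 0$, $\alpha\ne 1$, and let $c>0$. Let $L_{\alpha,c}$ be the Logitron loss function and let $$\mathcal{L}_{\alpha,c}(z)=\ln_{\alpha,c}\big(c+\mathrm{Exp}_{\alpha,c}(-z)\big),\qquad \mathrm{Exp}_{\alpha,c}(z)=\big(\max(0,\,c^{1-\alpha}+(1-\alpha)z)\big)^{1/(1-\alpha)}.$$ Then for all $z\in\mathbb{R}$, $$L_{\alpha,c}(z)=\begin{cases}\mathcal{L}_{\alpha,c}(z) & \text{if } \alpha\in[0,1),\\ \max\big(-z,\ \mathcal{L}_{\alpha,c}(z)\big) & \text{if } \alpha\in(1,\infty).\end{cases}$$
   Context: For $\alpha\ge 0$, $\alpha\neq 1$, $c>0$, put $c_\alpha=\frac{c^{1-\alpha}}{\alpha-1}$. Extended logarithm: $\ln_{\alpha,c}(u)=\frac{1}{1-\alpha}(u^{1-\alpha}-c^{1-\alpha})$, with domain $(0,\infty)$ if $\alpha> 1$ and $[0,\infty)$ if $0\le\alpha<1$. Extended exponential: $\exp_{\alpha,c}(v)=(c^{1-\alpha}+(1-\alpha)v)^{1/(1-\alpha)}$, with domain $\mathrm{dom}(\exp_{\alpha,c})=[c_\alpha,\infty)$ if $0\le\alpha<1$, and $(-\infty,c_\alpha)$ if $\alpha>1$. Extended logistic loss: $\ell_{\alpha,c}(z)=\ln_{\alpha,c}(c+\exp_{\alpha,c}(-z))$ for $z\in\mathrm{dom}(\ell_{\alpha,c})=\{z\in\mathbb{R}: -z\in\mathrm{dom}(\exp_{\alpha,c})\}$.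 Perceptron loss: $\ell_P(z)=\max(0,-z)$. Logitron loss: $L_{\alpha,c}(z)=\ell_{\alpha,c}(z)$ if $z\in\mathrm{dom}(\ell_{\alpha,c})$, and $L_{\alpha,c}(z)=\ell_P(z)$ otherwise. Conventions in the extended reals: $1/0=+\infty$, $1/\infty=0$, $a+\infty=\infty$ for $a\in\mathbb{R}$. Thus for $\alpha>1$, when the maximum in $\mathrm{Exp}_{\alpha,c}$ equals $0$, $\mathrm{Exp}_{\alpha,c}=0^{1/(1-\alpha)}=+\infty$, and $\ln_{\alpha,c}(c+\infty)=\ln_{\alpha,c}(+\infty)=c_\alpha$. *)

(* Defs.v *)
From mathcomp Require Import all_boot all_order all_algebra.
From mathcomp Require Import all_classical all_reals all_analysis.

Set Implicit Arguments.
Unset Strict Implicit.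
Unset Printing Implicit Defensive.

Import Order.TTheory GRing.Theory Num.Theory.

Local Open Scope ring_scope.

(* Real powers are the library's [powR], which sends 0 to 0 for every nonzero
   exponent and 0 `^ 0 to 1. In the real-valued definitions below the base is
   nonnegative on the stated domain, and positive when the exponent is
   negative, so [powR] is the usual power there. *)

Definition cconst {R : realType} (a c : R) : R := c `^ (1 - a) / (a - 1).

(* Meaningful for u > 0 if a > 1, and for u >= 0 if 0 <= a < 1. *)
Definition xln {R : realType} (a c u : R) : R :=
  (u `^ (1 - a) - c `^ (1 - a)) / (1 - a).

Definition xexp {R : realType} (a c v : R) : R :=
  (c `^ (1 - a) + (1 - a) * v) `^ (1 - a)^-1.

Definition dom_xexp {R : realType} (a c : R) : interval R :=
  if a < 1 then `[cconst a c, +oo[ else `]-oo, cconst a c[.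

Definition xlogistic {R : realType} (a c z : R) : R :=
  xln a c (c + xexp a c (- z)).

Definition dom_xlogistic {R : realType} (a c : R) : pred R :=
  [pred z | - z \in dom_xexp a c].

Definition perceptron {R : realType} (z : R) : R := Num.max 0 (- z).

Definition logitron {R : realType} (a c z : R) : R :=
  if z \in dom_xlogistic a c then xlogistic a c z else perceptron z.

Local Open Scope ereal_scope.

(* Power of a nonnegative extended real. The library's [poweR] sends both 0
   to 0 and +oo to +oo for negative exponents, so those are computed as
   1 / x ^ (- r), where the library inverse satisfies 0^-1 = +oo and
   (+oo)^-1 = 0. *)
Definition epow {R : realType} (x : \bar R) (r : R) : \bar R :=
  if (0 <= r)%R then x `^ r else (x `^ (- r))^-1.

(* [xln] on nonnegative extended reals. *)
Definition eln {R : realType} (a c : R) (u : \bar R) : \bar R :=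
  ((1 - a)^-1)%:E * (epow u (1 - a) - (c `^ (1 - a))%:E).

(* Defined on the whole real line, with values in [0, +oo]. *)
Definition eExp {R : realType} (a c z : R) : \bar R :=
  epow (Num.max 0 (c `^ (1 - a) + (1 - a) * z))%:E (1 - a)^-1.

Definition eLogistic {R : realType} (a c z : R) : \bar R :=
  eln a c (c%:E + eExp a c (- z)).

(* Main.v *)
(** On the domain the truncation in [eExp] is inactive, so both losses agree;
    for [a > 1] the maximum is harmless there, since [xln] is nondecreasing and
    [- z = xln (xexp (- z)) <= xln (c + xexp (- z))].  Off the domain, if
    [a < 1] then [z > 0], [eExp] vanishes and both sides are [xln c = 0]; if
    [a > 1] then [eExp = +oo], so [eLogistic] is the constant [cconst a c],
    which is at most [- z]. *)

Require Import Defs.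
From mathcomp Require Import all_boot all_order all_algebra.
From mathcomp Require Import all_classical all_reals all_analysis.
From mathcomp Require Import lra.

Import Order.TTheory GRing.Theory Num.Theory.

Local Open Scope ring_scope.

(** The hypothesis excludes only the pole, base 0 with a negative exponent, where [epow] gives [+oo]
    but [powR] gives 0. *)
Lemma epow_EFin (R : realType) (x r : R) :
  (x != 0) || (0 <= r) -> epow x%:E r = (x `^ r)%:E.
Proof.
rewrite /epow; case: (lerP 0 r) => [_ _|_]; first by rewrite poweR_EFin.
rewrite orbF => x0.
by rewrite poweR_EFin inver powR_eq0 (negPf x0) /= powRN invrK.
Qed.

Lemma epow0_neg (R : realType) (r : R) : r < 0 -> epow 0%:E r = +oo%E.
Proof.
move=> r0; rewrite /epow ifN -?ltNge // poweR_EFin powR0 ?inve0 //.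
by rewrite oppr_eq0 lt_eqF.
Qed.

Lemma epowy_neg (R : realType) (r : R) : r < 0 -> epow +oo%E r = 0%:E.
Proof.
by move=> r0; rewrite /epow ifN -?ltNge // poweRE oppr_eq0 lt_eqF //= eqxx invey.
Qed.

Lemma eln_EFin (R : realType) (a c u : R) :
  0 < u -> eln a c u%:E = (xln a c u)%:E.
Proof.
move=> u0; rewrite /eln epow_EFin ?gt_eqF // -EFinB -EFinM.
by rewrite /xln mulrC.
Qed.

Lemma elny (R : realType) (a c : R) : 1 < a -> eln a c +oo%E = (cconst a c)%:E.
Proof.
move=> a1; rewrite /eln epowy_neg ?subr_lt0 // -EFinB -EFinM /cconst.
by rewrite sub0r mulrN mulrC -mulrN -invrN opprB.
Qed.

Lemma xln_id (R : realType) (a c : R) : xln a c c = 0.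
Proof. by rewrite /xln subrr mul0r. Qed.

(** The two exponents multiply to 1, and [powR] with exponent 1 fixes nonnegative bases. Base 0 is
    allowed even for [a > 1], because [powR] keeps 0 at 0 there. *)
Lemma xexpK (R : realType) (a c v : R) : a != 1 ->
  0 <= c `^ (1 - a) + (1 - a) * v -> xln a c (xexp a c v) = v.
Proof.
move=> a1 b0; have a1' : 1 - a != 0 by rewrite subr_eq0 eq_sym.
by rewrite /xln /xexp -powRrM mulVf // powRr1 // addrC addKr mulrC mulKf.
Qed.

(** Two reversals cancel: the power is the inverse of the increasing [u ^ (a - 1)], and the factor
    [1 / (1 - a)] is negative. *)
Lemma ler_xln (R : realType) (a c u v : R) : 1 < a ->
  0 < u -> u <= v -> xln a c u <= xln a c v.
Proof.
move=> a1 u0 uv; have v0 := lt_le_trans u0 uv.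
rewrite /xln ler_nM2r ?invr_lt0 ?subr_lt0 // lerD2r -(opprB a 1) !powRN.
by rewrite lef_pV2 ?posrE ?powR_gt0 // ge0_ler_powR ?nnegrE ?subr_ge0 // ltW.
Qed.

Lemma mem_dom_xlogistic_lt1 (R : realType) (a c z : R) : a < 1 ->
  (z \in dom_xlogistic a c) = (0 <= c `^ (1 - a) + (1 - a) * - z).
Proof.
move=> a1; rewrite inE /= /dom_xexp a1 in_itv /= andbT /cconst.
by rewrite ler_ndivrMr ?subr_lt0 //; apply/idP/idP => ?; lra.
Qed.

(** Strict, unlike the case [a < 1]: the open endpoint [cconst a c] is where the base vanishes and
    its negative power blows up. *)
Lemma mem_dom_xlogistic_gt1 (R : realType) (a c z : R) : 1 < a ->
  (z \in dom_xlogistic a c) = (0 < c `^ (1 - a) + (1 - a) * - z).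
Proof.
move=> a1; rewrite inE /= /dom_xexp ltNge (ltW a1) /= in_itv /= /cconst.
by rewrite ltr_pdivlMr ?subr_gt0 //; apply/idP/idP => ?; lra.
Qed.

Lemma eLogistic_dom (R : realType) (a c z : R) : a != 1 -> 0 < c ->
  z \in dom_xlogistic a c -> eLogistic a c z = (xlogistic a c z)%:E.
Proof.
move=> a1 c0 zdom; rewrite /eLogistic /eExp.
(* The first fact removes the truncation; the second keeps the power away from the pole. *)
suff [b0 b] : 0 <= c `^ (1 - a) + (1 - a) * - z /\
    (c `^ (1 - a) + (1 - a) * - z != 0) || (0 <= (1 - a)^-1).
  rewrite max_r // epow_EFin // -EFinD eln_EFin //.
  by rewrite ltr_wpDr // powR_ge0.
case: (ltgtP a 1) a1 => // a1 _; move: zdom.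
  by rewrite mem_dom_xlogistic_lt1 // invr_ge0 subr_ge0 (ltW a1) orbT.
by rewrite mem_dom_xlogistic_gt1 // => b0; rewrite ltW // gt_eqF.
Qed.

Lemma logitron_lt1 (R : realType) (a c z : R) : a < 1 -> 0 < c ->
  (logitron a c z)%:E = eLogistic a c z.
Proof.
move=> a1 c0; rewrite /logitron; case: ifPn => [zdom|].
  by rewrite eLogistic_dom // lt_eqF.
rewrite mem_dom_xlogistic_lt1 // -ltNge => b0.
(* For [z <= 0] both summands of the base would be nonnegative. *)
have z0 : 0 < z.
  rewrite ltNge; apply/negP => z0.
  move: b0; rewrite ltNge addr_ge0 ?powR_ge0 // mulr_ge0 ?oppr_ge0 //.
  by rewrite subr_ge0 ltW.
rewrite /perceptron max_l ?oppr_le0 ?ltW // /eLogistic /eExp max_l ?ltW //.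
have i0 : 0 < (1 - a)^-1 by rewrite invr_gt0 subr_gt0.
rewrite epow_EFin ?(ltW i0) ?orbT // powR0 ?gt_eqF // -EFinD addr0.
by rewrite eln_EFin // xln_id.
Qed.

Lemma logitron_gt1 (R : realType) (a c z : R) : 1 < a -> 0 < c ->
  (logitron a c z)%:E = Order.max (- z)%:E (eLogistic a c z).
Proof.
move=> a1 c0; have a_neq1 : a != 1 by rewrite gt_eqF.
rewrite /logitron; case: ifPn => [zdom|].
  rewrite eLogistic_dom // max_r // lee_fin /xlogistic.
  move: zdom; rewrite mem_dom_xlogistic_gt1 // => b0.
  rewrite -[leLHS](@xexpK _ a c) ?(ltW b0) //.
  by rewrite ler_xln ?powR_gt0 // lerDr ltW.
rewrite mem_dom_xlogistic_gt1 // -leNgt => b0.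
have cz : cconst a c <= - z by rewrite ler_pdivrMr ?subr_gt0 //; lra.
(* Since [cconst a c] is nonnegative for [a > 1], the perceptron loss is [- z] here. *)
have z0 : 0 <= - z.
  by apply: le_trans cz; rewrite divr_ge0 ?powR_ge0 // subr_ge0 ltW.
suff -> : eLogistic a c z = (cconst a c)%:E.
  by rewrite /perceptron max_r // max_l // lee_fin.
rewrite /eLogistic /eExp max_l // epow0_neg ?invr_lt0 ?subr_lt0 //.
by rewrite addey // elny.
Qed.

Theorem mainTheorem3 (R : realType) (alpha : rat) (c : R)
    (alpha_ge0 : 0 <= alpha) (alpha_neq1 : alpha != 1) (c_gt0 : 0 < c) (z : R) :
  let a : R := ratr alpha in
  (logitron a c z)%:E =
    if alpha < 1 then eLogistic a c z
    else Order.max (- z)%:E (eLogistic a c z).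
Proof.
move=> a; have a1 : (a < 1) = (alpha < 1) by rewrite -(ltr_rat R) rmorph1.
have a1' : (1 < a) = (1 < alpha) by rewrite -(ltr_rat R) rmorph1.
case: ltgtP alpha_neq1 => // alpha1 _.
  by rewrite logitron_lt1 // a1.
by rewrite logitron_gt1 // a1'.
Qed.
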